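(* Let $X=\mathbb{R}^{\mathbb{N}}$ and $Y=(2^{\mathbb{N}})^{\mathbb{N}}$, and let $P\subseteq X\times Y$, the relation $E$ on $P$, the relation $F=(=_{\mathbb{R}})^+$ on $X$, and the relation $G=(=_{2^{\mathbb{N}}})^+$ on $(2^{\mathbb{N}})^{\mathbb{N}}$ be as defined in the context. Then all of the following hold: (i) $P$ is a Borel subset of $X\times Y$, and $E$, $F$, $G$ are Borel equivalence relations on $P$, $X$, $(2^{\mathbb{N}})^{\mathbb{N}}$ respectively; (ii) for all $(x,y),(x',y')\in P$, if $(x,y)\mathrel{E}(x',y')$ then $x\mathrel{F}x'$; (iii) for every $x_0\in X$, $E\restriction\{(x,y)\in P : x\mathrel{F}x_0\}\leq_B G$; (iv) $E\not\leq_B F\times G$. Consequently, the following assertion is false: ''For all Polish spaces $X,Y$, every Borel set $P\subseteq X\times Y$, every Borel equivalence relation $F$ on $X$, every Borel equivalence relation $E$ on $P$ such that $(x,y)\mathrel{E}(x',y')$ implies $x\mathrel{F}x'$ for all $(x,y),(x',y')\in P$, and every Borel equivalence relation $G$ on a Polish space such that $E\restriction\{(x,y)\in P : x\mathrel{F}x_0\}\leq_B G$ for every $x_0\in X$, one has $E\leq_B F\times G$.''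
   Context: Borel reducibility. Let $E_1,E_2$ be equivalence relations on Polish spaces (or Borel subsets of Polish spaces) $X_1,X_2$. We write $E_1\leq_B E_2$ if there is a Borel measurable function $f\colon X_1\to X_2$ such that for all $a,b\in X_1$: $a\mathrel{E_1}b\iff f(a)\mathrel{E_2}f(b)$. An equivalence relation on such a space $Z$ is Borel if it is a Borel subset of $Z\times Z$. For a subset $Q$ of the domain of $E_1$, $E_1\restriction Q$ denotes the restriction of $E_1$ to $Q$. Products. For equivalence relations $F_1,F_2$ on $Y_1,Y_2$, the relation $F_1\times F_2$ on $Y_1\times Y_2$ is defined by: $(y_1,y_2)$ and $(y_1',y_2')$ are related iff $y_1\mathrel{F_1}y_1'$ and $y_2\mathrel{F_2}y_2'$. Friedman-Stanley jump. For an equivalence relation $R$ on a Polish space $Z$, $R^+$ is the equivalence relation on $Z^{\mathbb{N}}$ (product topology) given by $x\mathrel{R^+}y$ iff $\forall n\,\exists m\,(x(n)\mathrel{R}y(m))$ and $\forall n\,\exists m\,(y(n)\mathrel{R}x(m))$; that is, $\{[x(n)]_R : n\in\mathbb{N}\}=\{[y(n)]_R : n\in\mathbb{N}\}$. Notation. $=_{\mathbb{R}}$ and $=_{2^{\mathbb{N}}}$ are the equality relations on $\mathbb{R}$ and on $2^{\mathbb{N}}$, where $2^{\mathbb{N}}$ is the space of binary sequences with the product topology ($2=\{0,1\}$ discrete). $\mathbb{R}^{\mathbb{N}}$, $(2^{\mathbb{N}})^{\mathbb{N}}$ and $\mathbb{R}^{\mathbb{N}}\times(2^{\mathbb{N}})^{\mathbb{N}}$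 carry the product topologies. The relations $F$ and $G$. $F=(=_{\mathbb{R}})^+$ on $\mathbb{R}^{\mathbb{N}}$, i.e. $x\mathrel{F}x'$ iff $\{x(m):m\in\mathbb{N}\}=\{x'(m):m\in\mathbb{N}\}$. $G=(=_{2^{\mathbb{N}}})^+$ on $(2^{\mathbb{N}})^{\mathbb{N}}$. The set $P$ and relation $E$. For $(x,y)\in\mathbb{R}^{\mathbb{N}}\times(2^{\mathbb{N}})^{\mathbb{N}}$ and $n\in\mathbb{N}$, let $A^{(x,y)}_n=\{x(m) : y(n)(m)=1\}$. Let $P$ be the set of all $(x,y)\in\mathbb{R}^{\mathbb{N}}\times(2^{\mathbb{N}})^{\mathbb{N}}$ such that (1) $\forall m\,\exists k\,(y(k)(m)=1)$; (2) $\forall k\,\exists m\,(y(k)(m)=1)$; (3) $\forall k,l_1,l_2\,(x(l_1)=x(l_2)\rightarrow y(k)(l_1)=y(k)(l_2))$. Define $E$ on $P$ by $(x,y)\mathrel{E}(x',y')$ iff $\{A^{(x,y)}_n : n\in\mathbb{N}\}=\{A^{(x',y')}_n : n\in\mathbb{N}\}$. *)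

(* Defs.v *)
From mathcomp Require Import all_boot all_order all_algebra.
From mathcomp Require Import all_classical all_reals all_analysis.
From Corelib Require Import RelationClasses.

Set Implicit Arguments.
Unset Strict Implicit.
Unset Printing Implicit Defensive.

Import Order.TTheory GRing.Theory Num.Theory.
Import numFieldNormedType.Exports.

Local Open Scope classical_set_scope.
Local Open Scope ring_scope.

(** A subset [Q] of a space is viewed as a space through [set_type Q], which the
    library equips with the subspace topology (initial topology of the inclusion
    [set_val]). Borel sets of [set_type Q] are therefore the traces on [Q] of the
    Borel sets of the ambient space. *)

Definition is_metric (R : realType) (T : Type) (d : T -> T -> R) : Prop :=
  [/\ forall x y, 0 <= d x y,
      forall x y, d x y = 0 <-> x = y,
      forall x y, d x y = d y x &
      forall x y z, d x z <= d x y + d y z].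

(** The metric is only asked to exist: being Polish is a property of the topology.
    The empty space is allowed. *)
Definition polish (R : realType) (T : topologicalType) : Prop :=
  (exists D : set T, countable D /\ dense D) /\
  exists d : T -> T -> R,
    [/\ is_metric d,
        forall (x : T) (A : set T),
          nbhs x A <-> exists2 e : R, 0 < e & [set y | d x y < e] `<=` A &
        forall u : nat -> T,
          (forall e : R, 0 < e -> exists N : nat, forall m n : nat,
             (N <= m)%N -> (N <= n)%N -> d (u m) (u n) < e) ->
          exists l : T, u @ \oo --> l].

Definition borel (T : topologicalType) : set (set T) := <<s (@open T) >>.

Definition borel_fun (T1 T2 : topologicalType) (f : T1 -> T2) : Prop :=
  forall B : set T2, borel B -> borel (f @^-1` B).

Definition borel_equivalence (T : topologicalType) (E : T -> T -> Prop) : Prop :=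
  Equivalence E /\ borel [set p : T * T | E p.1 p.2].

Definition borel_reducible (T1 T2 : topologicalType)
    (E1 : T1 -> T1 -> Prop) (E2 : T2 -> T2 -> Prop) : Prop :=
  exists f : T1 -> T2, borel_fun f /\ forall a b, E1 a b <-> E2 (f a) (f b).

Definition restrict_rel (T : Type) (E : T -> T -> Prop) (Q : set T) :
    set_type Q -> set_type Q -> Prop :=
  fun a b => E (set_val a) (set_val b).

Definition prod_rel (T1 T2 : Type) (F1 : T1 -> T1 -> Prop) (F2 : T2 -> T2 -> Prop) :
    T1 * T2 -> T1 * T2 -> Prop :=
  fun p q => F1 p.1 q.1 /\ F2 p.2 q.2.

(** Friedman-Stanley jump. *)
Definition jump (Z : Type) (E : Z -> Z -> Prop) : (nat -> Z) -> (nat -> Z) -> Prop :=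
  fun x y => (forall n, exists m, E (x n) (y m)) /\
             (forall n, exists m, E (y n) (x m)).

(** [{ptws nat -> _}] is the countable power with the product topology. *)
Definition X_space (R : realType) : topologicalType := {ptws nat -> R}.
Definition Y_space : topologicalType := {ptws nat -> cantor_space}.

Definition F_rel (R : realType) : X_space R -> X_space R -> Prop := jump (@eq R).
Definition G_rel : Y_space -> Y_space -> Prop := jump (@eq cantor_space).

Definition A_set (R : realType) (p : X_space R * Y_space) (n : nat) : set R :=
  [set p.1 m | m in [set m | p.2 n m = true]].

Definition P_set (R : realType) : set (X_space R * Y_space) :=
  [set p | [/\ forall m, exists k, p.2 k m = true,
               forall k, exists m, p.2 k m = true &
               forall k l1 l2, p.1 l1 = p.1 l2 -> p.2 k l1 = p.2 k l2]].

(** [range (A_set p)] is the set of sets of reals {A_n : n in nat}. *)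
Definition E_rel (R : realType) : set_type (@P_set R) -> set_type (@P_set R) -> Prop :=
  fun p q => range (A_set (set_val p)) = range (A_set (set_val q)).

(** The part of [P] lying over the [F]-class of [x0]. *)
Definition over_class (X Y : Type) (P : set (X * Y)) (F : X -> X -> Prop) (x0 : X) :
    set (set_type P) :=
  [set p | F (set_val p).1 x0].

(* Main.v *)
Require Import Defs.
From mathcomp Require Import all_boot all_order all_algebra.
From mathcomp Require Import all_classical all_reals all_analysis.
From mathcomp Require Import lra zify.
From Corelib Require Import RelationClasses.
Import Order.TTheory GRing.Theory Num.Theory.
Import numFieldNormedType.Exports.

Set Implicit Arguments.
Unset Strict Implicit.
Unset Printing Implicit Defensive.

Local Open Scope classical_set_scope.
Local Open Scope ring_scope.

(** Why the theorem is true.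

    The union of the sets [A_n] of a point [(x, y)] of [P] is the range of [x], so
    [E]-related points have [F]-related first components. If [x] enumerates the
    range of a fixed [x0], each [A_n] is coded by the set of indices [m] with
    [x0 m \in A_n], that is, by a point of the Cantor space, and this coding
    reduces [E] over the class of [x0] to [G] ([restricted_E_reducible]).

    What fails is to do this for all [x] at once. A class of the product of [F] and [G] is in
    effect a countable set of reals together with a countable set of points of the Cantor
    space, and no such set can be attached to the classes of [E] in a faithful
    Borel way ([E_not_reducible]). The argument is a Baire category argument on a
    space of parameters [w = (a, y, s)]: a sequence [a] of binary sequences, read as
    distinct reals, a set [y] of indices, and an enumeration [s] of the indices. The
    parameter [w] yields a point [point w] of [P] whose reals are listed along [s] and
    whose sets are [{a_j : j in y}] and all sets differing from it by finitely many
    of the reals [a_j]. Its [E]-class depends neither on [s] nor on finite changes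
    of [y].

    Let [f] be a Borel reduction and look at one coordinate [c w] of [f (point w)].
    - For fixed [a] and [y], all values of [c] lie in one countable set, namely the
      coordinates of [f] at the parameter where [s] is the identity. By the Baire
      property, on a small open set [c] generically agrees with a single one of
      these, hence does not depend on [s] there.
    - Permuting the columns [(a_j, y_j)] and correcting [s] accordingly does not
      change [point w] at all. If the columns below [L] are kept, the permuted
      parameter stays in the small open set, so [c] is not changed by moving
      finitely many of the other columns away. Consequently no finite piece of
      information on the columns beyond [L] has any influence on [c]. In
      particular [c w] is generically unchanged when [y] is replaced by its
      complement beyond [L] ([generic_flip]).
    - Complementing [y] beyond [L] or everywhere gives the same [E]-class. So for
      generic [w] the images under [f] of the points of [w] and of
      [w' = (a, complement of y, s)] have the same coordinates up to order, and the
      two points are [E]-related. They are not, since [y] and its complement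
      differ at every index ([trace_flip0_neq]). *)

(** * Sigma-algebras, Borel sets and countable powers *)

(** Closure of a sigma-algebra under the connectives and countable quantifiers. It is
    applied to the Borel sets and to the sets with the Baire property. *)
Section SigmaAlgebra.
Context {T : Type} {S : set (set T)}.
Hypothesis S_sigma : sigma_algebra [set: T] S.
Implicit Types A B : set T.

Lemma sigmaC A : S A -> S (~` A).
Proof. by case: S_sigma => _ SC _ /SC; rewrite setTD. Qed.

Lemma sigma_exists (Q : nat -> set T) :
  (forall n, S (Q n)) -> S [set x | exists n, Q n x].
Proof.
case: S_sigma => _ _ SU SQ; have -> : [set x | exists n, Q n x] = \bigcup_n Q n.
  by apply/seteqP; split => x /= [n]; [exists n|move=> _; exists n].
exact: SU.
Qed.

Lemma sigma_forall (Q : nat -> set T) :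
  (forall n, S (Q n)) -> S [set x | forall n, Q n x].
Proof.
move=> SQ; have -> : [set x | forall n, Q n x] = ~` [set x | exists n, (~` Q n) x].
  apply/seteqP; split => x /=; first by move=> Qx [n]; apply.
  by move/forallNP => Qx n; apply: contrapT; exact: Qx.
by apply: sigmaC; apply: sigma_exists => n; exact: sigmaC.
Qed.

Lemma sigma_and A B : S A -> S B -> S [set x | A x /\ B x].
Proof.
move=> SA SB.
have -> : [set x | A x /\ B x] = [set x | forall n, (if n is 0%N then A else B) x].
  apply/seteqP; split => x /=; first by case=> ? ? [|n].
  by move=> AB; split; [exact: (AB 0%N)|exact: (AB 1%N)].
by apply: sigma_forall => -[|n].
Qed.

Lemma sigma_imp A B : S A -> S B -> S [set x | A x -> B x].
Proof.
move=> SA SB; have -> : [set x | A x -> B x] = ~` [set x | A x /\ (~` B) x].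
  apply/seteqP; split => x /=; first by move=> AB [/AB].
  by move=> nAB Ax; apply: contrapT => nBx; exact: nAB.
by apply/sigmaC/sigma_and => //; exact: sigmaC.
Qed.

End SigmaAlgebra.

Section BorelSets.
Context {T : topologicalType}.
Implicit Types A B : set T.

Lemma borel_sigma : sigma_algebra [set: T] (@borel T).
Proof. exact: smallest_sigma_algebra. Qed.

Lemma borel_open A : open A -> borel A.
Proof. by move=> oA; apply: sub_sigma_algebra. Qed.

Lemma borel_closed A : closed A -> borel A.
Proof.
by move=> cA; rewrite -(setCK A); apply: (sigmaC borel_sigma); apply: borel_open; rewrite openC.
Qed.

Lemma borel_const (P : Prop) : borel [set _ : T | P].
Proof.
have [HP|nP] := pselect P.
  have -> : [set _ : T | P] = setT by apply/seteqP; split.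
  by apply: borel_open; exact: openT.
have -> : [set _ : T | P] = set0 by apply/seteqP; split.
by apply: borel_open; exact: open0.
Qed.

Definition borelC := sigmaC borel_sigma.
Definition borel_exists := sigma_exists borel_sigma.
Definition borel_forall := sigma_forall borel_sigma.
Definition borel_and := sigma_and borel_sigma.
Definition borel_imp := sigma_imp borel_sigma.

End BorelSets.

Lemma borel_ind (T : topologicalType) (Q : set (set T)) :
  (forall A, open A -> Q A) -> (forall A, Q A -> Q (~` A)) ->
  (forall A : nat -> set T, (forall n, Q (A n)) -> Q (\bigcup_n A n)) ->
  forall A, borel A -> Q A.
Proof.
move=> Qo QC QU A; apply: smallest_sub => //; split=> //.
- by apply: Qo; exact: open0.
- by move=> B /QC; rewrite setTD.
Qed.

Lemma borel_fun_open (T1 T2 : topologicalType) (f : T1 -> T2) :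
  (forall B, open B -> borel (f @^-1` B)) -> borel_fun f.
Proof.
move=> fo; apply: borel_ind => // [A|A bA]; first by rewrite preimage_setC; exact: borelC.
by rewrite preimage_bigcup /borel; apply: sigma_algebra_bigcup.
Qed.

Lemma continuous_borel_fun (T1 T2 : topologicalType) (f : T1 -> T2) :
  continuous f -> borel_fun f.
Proof.
by move=> /continuousP cf; apply: borel_fun_open => B oB; apply: borel_open; exact: cf.
Qed.

Lemma ptws_cvg (T : topologicalType) (F : set_system {ptws nat -> T})
    (x : {ptws nat -> T}) :
  Filter F -> (forall n, (fun y : {ptws nat -> T} => y n) @ F --> x n) -> F --> x.
Proof.
move=> FF Fx; apply/cvg_sup => n A [B [[C oC <-] Cx] sA].
have : nbhs (x n) C by apply: open_nbhs_nbhs.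
by move/Fx => /(@filterS _ F FF _ _ sA).
Qed.

Lemma ptws_proj_continuous (T : topologicalType) n :
  continuous (fun x : {ptws nat -> T} => x n).
Proof. exact: (@proj_continuous _ (fun=> T)). Qed.

(** Each projection is continuous, and conversely the filter generated by the boxes
    constrained in finitely many coordinates converges to [x] in every coordinate,
    hence in the product. *)
Lemma ptws_nbhsP (T : topologicalType) (x : {ptws nat -> T}) (A : set {ptws nat -> T}) :
  nbhs x A <-> exists N (B : nat -> set T),
    (forall n, nbhs (x n) (B n)) /\
    [set y : {ptws nat -> T} | forall n, (n < N)%N -> B n (y n)] `<=` A.
Proof.
split; last first.
  move=> [N [B [Bx sA]]]; apply: (filterS sA) => {sA}.
  elim: N => [|N IH]; first by apply: (@filterS _ _ _ setT) => //; exact: filterT.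
  have := @ptws_proj_continuous T N x _ (Bx N).
  move: IH; apply: filterS2 => y yN BN n; rewrite ltnS leq_eqVlt.
  by move=> /orP[/eqP->|/yN].
pose D := [set NB : nat * (nat -> set T) | forall n, nbhs (x n) (NB.2 n)].
pose S (NB : nat * (nat -> set T)) :=
  [set y : {ptws nat -> T} | forall n, (n < NB.1)%N -> NB.2 n (y n)].
have FF : Filter (filter_from D S).
  apply: filter_from_filter; first by exists (0%N, fun=> setT) => n; exact: filterT.
  move=> [N1 B1] [N2 B2] D1 D2; exists (maxn N1 N2, fun n => B1 n `&` B2 n).
    by move=> n; apply: filterI; [exact: D1|exact: D2].
  move=> y /= Sy; split => n nN.
    by have [|//] := Sy n; rewrite leq_max nN.
  by have [|//] := Sy n; rewrite leq_max nN orbT.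
suff : filter_from D S --> x.
  by move=> /[apply] -[[N B] DB sA]; exists N, B.
apply: ptws_cvg => n C Cx; exists (n.+1, fun k => if k == n then C else setT).
  by move=> k /=; case: eqP => [->//|_]; exact: filterT.
by move=> y /(_ n (ltnSn n)) /=; rewrite eqxx.
Qed.

(** * The spaces involved are Polish *)

Section PolishPower.
Variables (R : realType) (T : topologicalType) (d : T -> T -> R).
Hypothesis d_metric : is_metric d.
Hypothesis d_nbhs : forall (x : T) (A : set T),
  nbhs x A <-> exists2 e : R, 0 < e & [set y | d x y < e] `<=` A.

Let w (n : nat) : R := n.+1%:R^-1.

Let w_gt0 n : 0 < w n. Proof. by rewrite /w invr_gt0 ltr0n. Qed.

Let w_le1 n : w n <= 1.
Proof. by rewrite /w invf_le1 ?ltr0n // ler1n. Qed.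

Let w_small (e : R) : 0 < e -> exists N, forall n, (N <= n)%N -> w n < e.
Proof.
move=> e0; exists (Num.bound e^-1) => n Nn.
rewrite /w -[ltRHS]invrK ltf_pV2 ?posrE ?invr_gt0 ?ltr0n //.
apply: (lt_le_trans (archi_boundP _)); first by rewrite invr_ge0 ltW.
by rewrite ler_nat (leq_trans Nn).
Qed.

(** The weights [1 / (n + 1)] truncate the distances of the coordinates; they tend to
    [0], so a ball constrains only finitely many coordinates. A supremum is
    convenient because [<=] can be tested coordinate by coordinate. *)
Definition power_dist (x y : {ptws nat -> T}) : R :=
  sup (range (fun n => Num.min (d (x n) (y n)) (w n))).

Lemma power_dist_le x y e :
  power_dist x y <= e <-> forall n, Num.min (d (x n) (y n)) (w n) <= e.
Proof.
split=> [xye n|xye].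
  apply: le_trans xye; apply: sup_ubound; last by exists n.
  by exists 1 => _ [k _ <-]; rewrite ge_min w_le1 orbT.
apply: ge_sup; first by eexists; exists 0%N.
by move=> _ [n _ <-].
Qed.

Lemma power_dist_coord x y n e :
  power_dist x y < Num.min e (w n) -> d (x n) (y n) < e.
Proof.
move=> xy; have /power_dist_le /(_ n) := lexx (power_dist x y).
move=> /le_lt_trans /(_ xy); rewrite lt_min !gt_min ltxx orbF => /andP[+ dw].
by move=> /orP[//|we]; exact: lt_trans we.
Qed.

Lemma power_dist_metric : is_metric power_dist.
Proof.
case: d_metric => d_ge0 d_eq0 dC d_triangle.
have min_ge0 x y n : 0 <= Num.min (d x y) (w n) by rewrite le_min d_ge0 ltW.
split.
- move=> x y; have /power_dist_le /(_ 0%N) := lexx (power_dist x y).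
  exact: le_trans.
- move=> x y; split=> [xy0|->].
    apply/funext => n; apply/d_eq0/eqP; rewrite eq_le d_ge0 andbT.
    have : power_dist x y <= 0 by rewrite xy0.
    move=> /power_dist_le /(_ n); rewrite ge_min => /orP[//|].
    by rewrite leNgt w_gt0.
  apply/eqP; rewrite eq_le; apply/andP; split.
    by apply/power_dist_le => n; rewrite ge_min (d_eq0 _ _).2 ?lexx.
  have /power_dist_le /(_ 0%N) := lexx (power_dist y y).
  exact: le_trans.
- move=> x y; rewrite /power_dist.
  by under eq_fun do rewrite dC.
- move=> x y z; apply/power_dist_le => n.
  have /power_dist_le /(_ n) := lexx (power_dist x y).
  have /power_dist_le /(_ n) := lexx (power_dist y z).
  move: (d_triangle (x n) (y n) (z n)) (d_ge0 (x n) (y n)) (d_ge0 (y n) (z n)) (w_gt0 n).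
  rewrite !ge_min => d3 d1 d2 wn /orP[] yz /orP[] xy; lra.
Qed.

Lemma power_dist_nbhs (x : {ptws nat -> T}) (A : set {ptws nat -> T}) :
  nbhs x A <-> exists2 e : R, 0 < e & [set y | power_dist x y < e] `<=` A.
Proof.
split=> [/ptws_nbhsP[N [B [xB sA]]]|[e e0 sA]].
  have [e e0 eB] : exists2 e : R, 0 < e & forall n, (n < N)%N ->
      forall y : {ptws nat -> T}, power_dist x y < e -> B n (y n).
    elim: N {sA} => [|N [e e0 eB]]; first by exists 1.
    have /d_nbhs[e' e'0 e'B] := xB N.
    exists (Num.min e (Num.min e' (w N))); first by rewrite !lt_min e0 e'0 w_gt0.
    move=> n; rewrite ltnS leq_eqVlt => /orP[/eqP->|nN] y; rewrite lt_min => /andP[xy1 xy2].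
      by apply: e'B; exact: power_dist_coord xy2.
    exact: eB.
  by exists e => // y xy; apply: sA => n nN; exact: eB xy.
have e20 : 0 < e / 2 by rewrite divr_gt0.
have [N Nw] := w_small e20.
apply/ptws_nbhsP; exists N, (fun n => [set t | d (x n) t < e / 2]); split.
  by move=> n; apply/d_nbhs; exists (e / 2).
move=> y xy; apply: sA => /=.
suff : power_dist x y <= e / 2 by lra.
apply/power_dist_le => n; rewrite ge_min.
have [nN|nN] := ltnP n N; first by rewrite (ltW (xy n nN)).
by rewrite (ltW (Nw n nN)) orbT.
Qed.

End PolishPower.

Lemma countable_range (I : countType) (T : Type) (f : I -> T) : countable (range f).
Proof. by apply: sub_countable (card_image_le _ _) _. Qed.

Lemma countable_sub_range (T : Type) (t : T) (D : set T) :
  countable D -> exists g : nat -> T, D `<=` range g.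
Proof.
move=> /countable_injP[f injf].
exists (fun n => if pselect (exists2 t, D t & f t = n) is left h
                 then sval (cid2 h) else t) => u Du.
exists (f u) => //; case: pselect => [h|[]]; last by exists u.
by case: (cid2 h) => v Dv /= vu; apply: injf => //; rewrite inE.
Qed.

(** Density: sequences whose coordinates run through a countable dense set of [T] and are
    eventually constant already meet every box. Completeness: a Cauchy sequence is
    Cauchy in each coordinate, and the coordinatewise limits give the limit. *)
Lemma polish_power (R : realType) (T : topologicalType) :
  polish R T -> polish R {ptws nat -> T}.
Proof.
move=> [[D [cD dD]] [d [d_metric d_nbhs d_complete]]]; split.
  have [[t]|T0] := pselect (inhabited T); last first.
    by exists set0; split=> // O [x _]; case: T0; exists; exact: (x 0%N).
  have [g Dg] := countable_sub_range t cD.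
  exists (range (fun (s : seq nat) (n : nat) => g (nth 0%N s n))).
  split; first exact: countable_range.
  move=> O [x Ox] oO.
  have /ptws_nbhsP[N [B [xB sO]]] : nbhs x O by apply: open_nbhs_nbhs.
  have /choice[k kB] n : exists k, B n (g k).
    have [u []] := dD _ (ex_intro _ _ (nbhs_singleton (nbhs_interior (xB n))))
      (open_interior _).
    by move=> /interior_subset uB /Dg[k _ ku]; exists k; rewrite ku.
  exists (fun n => g (nth 0%N (mkseq k N) n)); split; last by exists (mkseq k N).
  by apply: sO => n nN; rewrite nth_mkseq.
exists (power_dist d); split.
- exact: power_dist_metric.
- exact: power_dist_nbhs.
- move=> u u_cauchy.
  have /choice[l ul] n : exists l : T, (fun m => u m n) @ \oo --> l.
    apply: d_complete => e e0.
    have [|N uN] := u_cauchy (Num.min e n.+1%:R^-1).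
      by rewrite lt_min e0 invr_gt0 ltr0n.
    by exists N => m k Nm Nk; exact: (power_dist_coord (uN m k Nm Nk)).
  by exists l; apply: ptws_cvg.
Qed.

Lemma polish_real (R : realType) : polish R R.
Proof.
split; first by exists (range (@ratr R)); split; [exact: countable_range|exact: dense_rat].
exists (fun x y => `|x - y|); split.
- split=> [x y|x y|x y|x y z].
  + exact: normr_ge0.
  + split=> [/eqP|->]; last by rewrite subrr normr0.
    by rewrite normr_eq0 subr_eq0 => /eqP.
  + exact: distrC.
  + by apply: le_trans (ler_normD _ _); rewrite addrA subrK.
- by move=> x A; exact: (@nbhs_ballP R R x A).
- move=> u u_cauchy; suff /cauchy_cvgP : cauchy (u @ \oo) by move=> /cvg_ex.
  apply/cauchy_exP => e e0.
  have [N uN] := u_cauchy e e0; exists (u N).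
  by exists N => // n /= Nn; exact: uN.
Qed.

Lemma polish_bool (R : realType) : polish R bool.
Proof.
split.
  exists setT; split; first exact: countableP.
  by move=> O [b Ob] _; exists b.
exists (fun b c => (b != c)%:R); split.
- split.
  + by move=> b c; rewrite ler0n.
  + by move=> [] []; rewrite /=; split => // /eqP; rewrite oner_eq0.
  + by move=> [] [].
  + by move=> [] [] [] /=; lra.
- move=> b A; split=> [/nbhs_singleton Ab|[e e0 sA]].
    exists 1 => // c /=; case: eqP => [<- //|_]; by rewrite ltxx.
  by apply: (filterS _ (discrete_set1 b)) => _ ->; apply: sA; rewrite /= eqxx.
- move=> u u_cauchy; have [N uN] := u_cauchy 1 ltr01.
  exists (u N); apply: cvg_near_cst; exists N => // n /= Nn.
  have := uN n N Nn (leqnn N); case: eqP => [->//|_]; by rewrite ltxx.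
Qed.

Lemma polish_X (R : realType) : polish R (X_space R).
Proof. exact: (polish_power (@polish_real R)). Qed.

Lemma polish_Y (R : realType) : polish R Y_space.
Proof. by apply: polish_power; exact: (polish_power (polish_bool R)). Qed.

(** * The relations are Borel, and E reduces to G over each F-class *)

Lemma borel_eq_real (R : realType) (T : topologicalType) (u v : T -> R) :
  continuous u -> continuous v -> borel [set t | u t = v t].
Proof.
move=> cu cv.
have -> : [set t | u t = v t] = (fun t => u t - v t) @^-1` [set x | x = 0].
  apply/seteqP; split => t /= => [->|/eqP]; first by rewrite subrr.
  by rewrite subr_eq0 => /eqP.
apply: (continuous_borel_fun (fun t => cvgB (cu t) (cv t))).
by apply: borel_closed; exact: closed_eq.
Qed.

Lemma borel_true (T : topologicalType) (u : T -> bool) :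
  continuous u -> borel [set t | u t = true].
Proof.
move=> cu; have := continuous_borel_fun cu (B := [set true]); apply.
by apply: borel_open; exact: discrete_open.
Qed.

Lemma ptws_coord_continuous (S T : topologicalType) (x : S -> {ptws nat -> T}) n :
  continuous x -> continuous (fun s => x s n).
Proof.
move=> cx s; pose pr (z : {ptws nat -> T}) := z n.
exact: (@continuous_comp _ _ _ x pr s (cx s) (@ptws_proj_continuous T n (x s))).
Qed.

Lemma X_coord_continuous (R : realType) (S : topologicalType) (x : S -> X_space R) n :
  continuous x -> continuous (fun s => x s n).
Proof. by move=> cx; exact: (@ptws_coord_continuous S R x n cx). Qed.

Lemma Y_coord_continuous (S : topologicalType) (y : S -> Y_space) n m :
  continuous y -> continuous (fun s => y s n m).
Proof.
move=> cy; apply: (@ptws_coord_continuous S bool (fun s => y s n)).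
exact: (@ptws_coord_continuous S cantor_space y n cy).
Qed.

Lemma set_val_continuous (T : topologicalType) (A : set T) :
  continuous (set_val : set_type A -> T).
Proof. exact: initial_continuous. Qed.

(** Equality of two sets [A_n] in terms of the coordinates, with quantifiers over
    natural numbers only. This is what makes [E] Borel. *)
Lemma A_set_eqP (R : realType) (p q : X_space R * Y_space) n m :
  A_set p n = A_set q m <->
  (forall i, p.2 n i = true -> exists j, q.2 m j = true /\ p.1 i = q.1 j) /\
  (forall i, q.2 m i = true -> exists j, p.2 n j = true /\ q.1 i = p.1 j).
Proof.
have sub p' q' k l : (A_set p' k `<=` @A_set R q' l) <->
    (forall i, p'.2 k i = true -> exists j, q'.2 l j = true /\ p'.1 i = q'.1 j).
  split=> [pq i pi|pq _ [i /= /pq[j [qj ->]] <-]]; last by exists j.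
  have [|j /= qj qpi] := pq (p'.1 i); first by exists i.
  by exists j.
by rewrite -!sub; split=> [->//|[pq qp]]; exact/seteqP.
Qed.

Lemma range_A_set_eqP (R : realType) (p q : X_space R * Y_space) :
  range (A_set p) = range (A_set q) <->
  (forall n, exists m, A_set p n = A_set q m) /\
  (forall n, exists m, A_set q n = A_set p m).
Proof.
split=> [pq|[pq qp]].
  split=> n.
    by have : range (A_set q) (A_set p n) by [rewrite -pq; exists n]; case=> m _; exists m.
  by have : range (A_set p) (A_set q n) by [rewrite pq; exists n]; case=> m _; exists m.
apply/seteqP; split=> _ [n _ <-].
  by have [m ->] := pq n; exists m.
by have [m ->] := qp n; exists m.
Qed.

Section BorelRelations.
Variables (R : realType) (T : topologicalType).
Variables (x x' : T -> X_space R) (y y' : T -> Y_space).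
Hypotheses (cx : continuous x) (cx' : continuous x').
Hypotheses (cy : continuous y) (cy' : continuous y').

Lemma borel_A_set_eq n m :
  borel [set t | A_set (x t, y t) n = A_set (x' t, y' t) m].
Proof.
under eq_set => t do rewrite (propext (A_set_eqP _ _ _ _)) /=.
by apply: borel_and; apply: borel_forall => i; apply: borel_imp;
  (try apply: borel_exists => j; try apply: borel_and);
  (apply: borel_true || apply: borel_eq_real); (apply: X_coord_continuous || apply: Y_coord_continuous).
Qed.

Lemma borel_P_set_preimage : borel [set t | P_set (x t, y t)].
Proof.
have -> : [set t | P_set (x t, y t)] = [set t |
    (forall m, exists k, y t k m = true) /\ (forall k, exists m, y t k m = true) /\
    (forall k l1 l2, x t l1 = x t l2 ->
       (y t k l1 = true -> y t k l2 = true) /\ (y t k l2 = true -> y t k l1 = true))].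
  apply/seteqP; split => t /= [P1].
    by move=> P2 P3; split=> //; split=> // k l1 l2 /(P3 k) /= ->.
  move=> [P2 P3]; split=> // k l1 l2 /(P3 k l1 l2)[? ?].
  by apply/idP/idP.
have ty n m : borel [set t | y t n m = true] by apply: borel_true; exact: Y_coord_continuous cy.
apply: borel_and; first by apply: borel_forall => m; apply: borel_exists => k; exact: ty.
apply: borel_and; first by apply: borel_forall => m; apply: borel_exists => k; exact: ty.
apply: borel_forall => k; apply: borel_forall => l1; apply: borel_forall => l2.
apply: borel_imp; first by apply: borel_eq_real; exact: X_coord_continuous cx.
by apply: borel_and; apply: borel_imp; exact: ty.
Qed.

End BorelRelations.

Lemma borel_P_set (R : realType) : borel (@P_set R).
Proof.
have -> : @P_set R = [set t | P_set (t.1, t.2)] by apply/seteqP; split => -[].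
by apply: borel_P_set_preimage => t; [exact: cvg_fst|exact: cvg_snd].
Qed.

Lemma jump_eq_equivalence (Z : Type) : Equivalence (jump (@eq Z)).
Proof.
split.
- by move=> x; split=> n; exists n.
- by move=> x y [].
- move=> x y z [xy yx] [yz zy]; split=> n.
    by have [m ->] := xy n; exact: yz.
  by have [m ->] := zy n; exact: yx.
Qed.

Lemma borel_equivalence_F (R : realType) : borel_equivalence (@F_rel R).
Proof.
split; first exact: jump_eq_equivalence.
by apply: borel_and; apply: borel_forall => n; apply: borel_exists => m;
  apply: borel_eq_real; apply: X_coord_continuous => t;
  (exact: cvg_fst || exact: cvg_snd).
Qed.

Lemma borel_equivalence_G : borel_equivalence G_rel.
Proof.
split; first exact: jump_eq_equivalence.
have beq (u v : Y_space * Y_space -> Y_space) n m : continuous u -> continuous v ->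
    borel [set p | u p n = v p m].
  move=> cu cv; have -> : [set p | u p n = v p m] = [set p | forall i,
      (u p n i = true -> v p m i = true) /\ (v p m i = true -> u p n i = true)].
    apply/seteqP; split => p /= => [-> //|uv]; apply/funext => i.
    by have [? ?] := uv i; apply/idP/idP.
  have tY (z : Y_space * Y_space -> Y_space) k i : continuous z ->
      borel [set p | z p k i = true].
    move=> cz; apply: borel_true.
    exact: Y_coord_continuous cz.
  by apply: borel_forall => i; apply: borel_and; apply: borel_imp; exact: tY.
by apply: borel_and; apply: borel_forall => n; apply: borel_exists => m;
  apply: beq => t; (exact: cvg_fst || exact: cvg_snd).
Qed.

Lemma borel_equivalence_E (R : realType) : borel_equivalence (@E_rel R).
Proof.
split; first by split=> [p|p q|p q r] //; rewrite /E_rel => ->.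
pose T := (set_type (@P_set R) * set_type (@P_set R))%type.
have c1 : continuous (fun t : T => set_val t.1).
  by move=> t; apply: continuous_comp; [exact: cvg_fst|exact: set_val_continuous].
have c2 : continuous (fun t : T => set_val t.2).
  by move=> t; apply: continuous_comp; [exact: cvg_snd|exact: set_val_continuous].
have cfst (z : T -> X_space R * Y_space) : continuous z -> continuous (fun t => (z t).1).
  by move=> cz t; apply: (continuous_comp (cz t)); exact: cvg_fst.
have csnd (z : T -> X_space R * Y_space) : continuous z -> continuous (fun t => (z t).2).
  by move=> cz t; apply: (continuous_comp (cz t)); exact: cvg_snd.
have bA (z z' : T -> X_space R * Y_space) n m : continuous z -> continuous z' ->
    borel [set t | A_set (z t) n = A_set (z' t) m].
  move=> cz cz'; have := borel_A_set_eq (cfst _ cz) (cfst _ cz') (csnd _ cz) (csnd _ cz') n m.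
  by under eq_set => t do rewrite -!surjective_pairing.
rewrite /E_rel; under eq_set => t do rewrite (propext (range_A_set_eqP _ _)).
by apply: borel_and; apply: borel_forall => n; apply: borel_exists => m; exact: bA.
Qed.

Lemma E_rel_F_rel (R : realType) (p q : set_type (@P_set R)) :
  E_rel p q -> F_rel (set_val p).1 (set_val q).1.
Proof.
have sub (p' q' : set_type (@P_set R)) : E_rel p' q' ->
    forall n, exists m, (set_val p').1 n = (set_val q').1 m.
  move=> /range_A_set_eqP[pq _] n; have [P1 _ _] := set_valP p'.
  have [k pkn] := P1 n; have [l /A_set_eqP[kl _]] := pq k.
  by have [j [_ ?]] := kl n pkn; exists j.
by move=> Epq; split; apply: sub.
Qed.

Lemma Y_space_cylinder (O : set Y_space) (z : Y_space) : nbhs z O ->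
  exists N, [set z' : Y_space |
    forall n m, (n < N)%N -> (m < N)%N -> z' n m = z n m] `<=` O.
Proof.
move=> /ptws_nbhsP[N [B [zB sO]]].
have /choice[M MB] n : exists M, forall a : cantor_space,
    (forall m, (m < M)%N -> a m = z n m) -> B n a.
  have /ptws_nbhsP[M [C [zC sB]]] := zB n.
  exists M => a az; apply: sB => m mM; rewrite /= az //.
  exact: nbhs_singleton (zC m).
exists (maxn N (\max_(n < N) M n)) => z' zz'; apply: sO => n nN; apply: MB => m mM.
apply: zz'; first by rewrite leq_max nN.
rewrite leq_max; apply/orP; right; apply: (leq_trans mM).
exact: (leq_bigmax (Ordinal nN)).
Qed.

(** There are only countably many cylinders, so the preimage of an open set is a countable
    union of Boolean combinations of the given sets. *)
Lemma borel_fun_Y_space (T : topologicalType) (r : T -> Y_space) :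
  (forall n m, borel [set t | r t n m = true]) -> borel_fun r.
Proof.
move=> br; apply: borel_fun_open => O oO.
pose cyl (c : nat * seq (seq bool)) : set Y_space := [set z | forall n m,
  (n < c.1)%N -> (m < c.1)%N -> z n m = nth false (nth [::] c.2 n) m].
have bcyl c : borel (r @^-1` cyl c).
  apply: borel_forall => n; apply: borel_forall => m.
  apply: borel_imp; first exact: borel_const.
  apply: borel_imp; first exact: borel_const.
  case: (nth false _ _); first exact: br.
  suff : borel [set t | r t n m = false] by [].
  have -> : [set t | r t n m = false] = ~` [set t | r t n m = true].
    by apply/seteqP; split => t /= => [->|/negP/negbTE].
  exact: borelC.
pose Q k t := if unpickle k is Some c then cyl c `<=` O /\ cyl c (r t) else False.
have -> : r @^-1` O = [set t | exists k, Q k t].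
  apply/seteqP; split => t /=; last first.
    by move=> [k]; rewrite /Q; case: unpickle => // c [cO]; exact: cO.
  move=> Ot; have [N NO] := Y_space_cylinder (open_nbhs_nbhs (conj oO Ot)).
  pose c := (N, mkseq (fun n => mkseq (r t n) N) N).
  have cE n m : (n < N)%N -> (m < N)%N -> nth false (nth [::] c.2 n) m = r t n m.
    by move=> nN mN; rewrite !nth_mkseq.
  exists (pickle c); rewrite /Q pickleK; split=> [z zc|n m nN mN].
    by apply: NO => n m nN mN; rewrite zc // cE.
  by rewrite cE.
apply: borel_exists => k; rewrite /Q; case: unpickle => [c|]; last exact: borel_const.
by apply: borel_and; [exact: borel_const|exact: bcyl].
Qed.

(** Over the class of [x0] all the sets [A_n] are sets of terms of [x0], and such a set is
    determined by the indices of its members. *)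
Lemma restricted_E_reducible (R : realType) (x0 : X_space R) :
  borel_reducible
    (restrict_rel (@E_rel R) (Q := over_class (P := @P_set R) (@F_rel R) x0)) G_rel.
Proof.
set Q := over_class _ _.
pose pt (t : set_type Q) : X_space R * Y_space := set_val (set_val t).
pose r (t : set_type Q) : Y_space := fun n m => `[< A_set (pt t) n (x0 m) >].
have rP t n m : r t n m = true <-> exists i, (pt t).2 n i = true /\ (pt t).1 i = x0 m.
  rewrite /r; split=> [/asboolP[i /= ? ?]|[i [? ?]]]; first by exists i.
  by apply/asboolP; exists i.
have cpt : continuous pt.
  move=> t; apply: (@continuous_comp _ _ _ set_val set_val); exact: set_val_continuous.
have c1 : continuous (fun t => (pt t).1).
  by move=> t; apply: (continuous_comp (cpt t)); exact: cvg_fst.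
have c2 : continuous (fun t => (pt t).2).
  by move=> t; apply: (continuous_comp (cpt t)); exact: cvg_snd.
exists r; split.
  apply: borel_fun_Y_space => n m; under eq_set => t do rewrite (propext (rP t n m)).
  apply: borel_exists => i; apply: borel_and.
    apply: borel_true.
    exact: Y_coord_continuous c2.
  apply: borel_eq_real; first exact: X_coord_continuous c1.
  exact: cst_continuous.
have rE t t' n m : A_set (pt t) n = A_set (pt t') m <-> r t n = r t' m.
  split=> [Att'|rr]; first by apply/funext => i; rewrite /r Att'.
  have sub s s' k l : r s k = r s' l -> A_set (pt s) k `<=` A_set (pt s') l.
    move=> rs _ [i /= si <-]; have [/(_ i)[j sj] _] := set_valP s.
    have : r s k j = true by apply/rP; exists i.
    by rewrite rs /pt => /asboolP; rewrite sj.
  by apply/seteqP; split; apply: sub; rewrite rr.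
move=> t t'; rewrite /restrict_rel /E_rel range_A_set_eqP /G_rel /jump.
by split=> -[tt' t't]; split=> n;
  [have [m /rE] := tt' n|have [m /rE] := t't n|have [m /rE] := tt' n|have [m /rE] := t't n];
  exists m.
Qed.

(** * Baire category on the space of parameters *)

(** A parameter: the digits [bits w j] of the [j]-th real, a set [sel w] of indices and a
    map [idx w] enumerating the indices. The column [j] is the pair
    [(bits w j, sel w j)]. The type is a copy of the Polish space
    [(2^N)^N * 2^N * N^N]. *)
Record sample := Sample {
  bits : nat -> nat -> bool;
  sel : nat -> bool;
  idx : nat -> nat }.

(** The cylinders [cyl u l] form a base of the product topology; they are used here in
    place of general open sets. *)
Definition agree (l : nat) (u v : sample) : Prop := forall j, (j < l)%N ->
  [/\ forall i, (i < l)%N -> bits u j i = bits v j i,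
      sel u j = sel v j & idx u j = idx v j].

Definition cyl (u : sample) (l : nat) : set sample := [set w | agree l u w].

Lemma agree_refl l u : agree l u u. Proof. by []. Qed.
#[local] Hint Resolve agree_refl : core.

Lemma agree_sym l u v : agree l u v -> agree l v u.
Proof. by move=> uv j jl; have [b s x] := uv j jl; split=> // i il; rewrite b. Qed.

Lemma agree_trans l u v w : agree l u v -> agree l v w -> agree l u w.
Proof.
move=> uv vw j jl; have [b s x] := uv j jl; have [b' s' x'] := vw j jl.
by split; [move=> i il; rewrite b // b'|rewrite s|rewrite x].
Qed.

Lemma agree_le l l' u v : (l <= l')%N -> agree l' u v -> agree l u v.
Proof.
move=> ll' uv j jl; have [b s x] := uv j (leq_trans jl ll'); split=> // i il.
exact: b (leq_trans il ll').
Qed.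

Definition nowhere_dense (N : set sample) := forall u l,
  exists v k, [/\ (l <= k)%N, agree l u v & cyl v k `<=` ~` N].

Definition meager (A : set sample) := exists N : nat -> set sample,
  (forall n, nowhere_dense (N n)) /\ A `<=` \bigcup_n N n.

Lemma nowhere_dense_meager A : nowhere_dense A -> meager A.
Proof. by move=> ndA; exists (fun=> A); split=> // w Aw; exists 0%N. Qed.

Lemma meager_sub A B : A `<=` B -> meager B -> meager A.
Proof. by move=> AB [N [ndN BN]]; exists N; split=> // w /AB /BN. Qed.

Lemma meager0 : meager set0.
Proof. by apply: nowhere_dense_meager => u l; exists u, l; split=> // w _ []. Qed.

Lemma meager_bigcup (I : countType) (A : I -> set sample) :
  (forall i, meager (A i)) -> meager (\bigcup_i A i).
Proof.
move=> /choice[N mN].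
exists (fun k => if unpickle k is Some (i, n) then N i n else set0); split=> [k|w [i _ Aw]].
  case: unpickle => [[i n]|]; first exact: (mN i).1.
  by move=> u l; exists u, l; split=> // w _ [].
have [n _ Nw] := (mN i).2 w Aw.
by exists (pickle (i, n)) => //; rewrite pickleK.
Qed.

Lemma meagerU A B : meager A -> meager B -> meager (A `|` B).
Proof.
move=> mA mB; apply: (@meager_sub _ (\bigcup_b (if b then A else B))).
  by move=> w [Aw|Bw]; [exists true|exists false].
by apply: meager_bigcup => -[].
Qed.

(** The Baire category theorem. The sets [N n] are avoided one after the other by shrinking
    the cylinder; its level at stage [n] exceeds [n], so the centres converge. *)
Lemma baire A u l : meager A -> exists2 w, cyl u l w & ~ A w.
Proof.
move=> [N [ndN AN]].
pose S := (sample * nat)%type.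
have /choice[step stepP] (p : nat * S) : exists q : S,
    [/\ (maxn p.1 p.2.2 <= q.2)%N, agree p.2.2 p.2.1 q.1 & cyl q.1 q.2 `<=` ~` N p.1].
  have [v [k [lk uv vN]]] := ndN p.1 p.2.1 (maxn p.1 p.2.2).
  exists (v, k); split=> //; apply: agree_le uv; exact: leq_maxr.
pose fix r n : S := if n is n'.+1 then step (n', r n') else (u, l).
have r_le n m : (n <= m)%N -> ((r n).2 <= (r m).2)%N /\ agree (r n).2 (r n).1 (r m).1.
  elim: m => [|m IH]; first by rewrite leqn0 => /eqP ->.
  have [rm mm _] := stepP (m, r m).
  rewrite leq_eqVlt => /orP[/eqP -> //|/IH [nm nm']]; split.
    by apply: leq_trans nm _; apply: leq_trans rm; exact: leq_maxr.
  by apply: agree_trans nm' _; exact: agree_le mm.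
have r_ge n : (n <= (r n.+1).2)%N.
  by have [rm _ _] := stepP (n, r n); apply: leq_trans rm; exact: leq_maxl.
pose w := Sample (fun j i => bits (r (maxn j i).+2).1 j i)
  (fun j => sel (r j.+2).1 j) (fun j => idx (r j.+2).1 j).
have rw n : agree (r n).2 (r n).1 w.
  move=> j jn.
  have near a b : (a <= b)%N -> (b < (r n).2)%N ->
    [/\ bits (r n).1 a b = bits (r b.+2).1 a b, bits (r n).1 b a = bits (r b.+2).1 b a,
        sel (r n).1 b = sel (r b.+2).1 b & idx (r n).1 b = idx (r b.+2).1 b].
    move=> ab bn; have [nb|bn'] := leqP n b.+2.
      have [_ e] := r_le _ _ nb.
      have [ba _ _] := e a (leq_ltn_trans ab bn); have [bb sb xb] := e b bn.
      by split=> //; [exact: ba|apply: bb; exact: leq_ltn_trans ab bn].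
    have [_ /agree_sym e] := r_le _ _ (ltnW bn').
    have bb2 : (b < (r b.+2).2)%N by exact: r_ge.
    have [ba _ _] := e a (leq_ltn_trans ab bb2); have [bb sb xb] := e b bb2.
    by split=> //; [exact: ba|apply: bb; exact: leq_ltn_trans ab bb2].
  have [_ _ sj xj] := near j j (leqnn j) jn; split=> // i ik.
  have [ji|/ltnW ij] := leqP j i; rewrite /w /=.
    by rewrite (maxn_idPr ji); have [-> _ _ _] := near j i ji ik.
  by rewrite (maxn_idPl ij); have [_ -> _ _] := near i j ij jn.
exists w; first exact: rw 0%N.
move=> /AN[n _]; have [_ _] := stepP (n, r n); apply; exact: rw n.+1.
Qed.

Lemma dense_samples : exists d : nat -> sample, forall u l, exists k, agree l (d k) u.
Proof.
pose dec k : seq (seq bool) * seq bool * seq nat := odflt ([::], [::], [::]) (unpickle k).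
exists (fun k => Sample (fun j i => nth false (nth [::] (dec k).1.1 j) i)
  (fun j => nth false (dec k).1.2 j) (fun j => nth 0%N (dec k).2 j)).
move=> u l; exists (pickle
  (mkseq (fun j => mkseq (bits u j) l) l, mkseq (sel u) l, mkseq (idx u) l)).
by move=> j jl; rewrite /= /dec pickleK /=; split=> [i il||]; rewrite !nth_mkseq.
Qed.

(** The space has a countable base. Hence the part of [A] covered by basic sets in which [A]
    is meager is itself meager, and what is left over is nowhere dense. *)
Lemma locally_meager A u l :
  (forall v k, (l <= k)%N -> agree l u v -> exists w k',
     [/\ (k <= k')%N, agree k v w & meager (cyl w k' `&` A)]) ->
  meager (cyl u l `&` A).
Proof.
move=> locA; have [d dP] := dense_samples.
pose small (p : nat * nat) := meager (cyl (d p.1) p.2 `&` A).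
pose N : set sample := [set w | cyl u l w /\ forall k, ~ meager (cyl w k `&` A)].
pose M p : set sample := [set w | small p /\ (cyl (d p.1) p.2 `&` A) w].
apply: (@meager_sub _ (N `|` \bigcup_p M p)).
  move=> w [uw Aw]; have [[k mk]|nk] := pselect (exists k, meager (cyl w k `&` A)).
    right; have [i iw] := dP w k; exists (i, k) => //; split; last by split.
    apply: meager_sub mk => z [iz Az]; split=> //.
    by apply: agree_trans iz; exact: agree_sym.
  by left; split=> // k mk; apply: nk; exists k.
apply: meagerU; last first.
  apply: meager_bigcup => p; have [sp|nsp] := pselect (small p).
    by apply: meager_sub sp => w [].
  by apply: meager_sub meager0 => w [].
apply: nowhere_dense_meager => v k.
have [[z [vz uz]]|nz] := pselect (exists z, cyl v k z /\ cyl u l z); last first.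
  by exists v, k; split=> // z vz [uz _]; apply: nz; exists z.
have [w [k' [kk' zw mw]]] := locA z (maxn k l) (leq_maxr _ _) uz.
exists w, k'; split.
- by apply: leq_trans kk'; exact: leq_maxl.
- by apply: agree_trans vz _; apply: agree_le zw; exact: leq_maxl.
- move=> y wy [_ /(_ k')]; apply; apply: meager_sub mw => x [yx Ax]; split=> //.
  exact: agree_trans wy yx.
Qed.

(** Every cylinder contains a cylinder on which [A] is either meager or comeager. In this
    space this is the usual Baire property, in the form of a forcing relation deciding
    membership in [A]. *)
Definition baire_property (A : set sample) := forall u l, exists v k,
  [/\ (l <= k)%N, agree l u v & meager (cyl v k `&` A) \/ meager (cyl v k `\` A)].

(** For a countable union: inside a given cylinder either some [A n] is comeager on a smaller
    one, or every [A n] is locally meager there, and then so is the union. *)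
Lemma baire_property_sigma : sigma_algebra setT baire_property.
Proof.
split.
- by move=> u l; exists u, l; split=> //; left; rewrite setI0; exact: meager0.
- move=> A bA u l; rewrite setTD; have [v [k [lk uv mA]]] := bA u l.
  exists v, k; split=> //; rewrite setDE setCK -setDE.
  by case: mA; [right|left].
- move=> A bA u l.
  have [[n [v [k [lk uv mA]]]]|noA] := pselect (exists n v k,
      [/\ (l <= k)%N, agree l u v & meager (cyl v k `\` A n)]).
    exists v, k; split=> //; right; apply: meager_sub mA => w [vw nw].
    by split=> // Aw; apply: nw; exists n.
  exists u, l; split=> //; left; rewrite setI_bigcupr.
  apply: meager_bigcup => n; apply: locally_meager => v k lk uv.
  have [w [k' [kk' vw [mA|mA]]]] := bA n v k; first by exists w, k'.
  case: noA; exists n, w, k'; split=> //; first exact: leq_trans kk'.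
  by apply: agree_trans uv _; exact: agree_le vw.
Qed.

Lemma baire_property_open (A : set sample) :
  (forall u, A u -> exists l, cyl u l `<=` A) -> baire_property A.
Proof.
move=> oA u l; have [[v [uv Av]]|nv] := pselect (exists v, cyl u l v /\ A v).
  have [k vA] := oA v Av; exists v, (maxn l k); split=> //; first exact: leq_maxl.
  right; apply: meager_sub meager0 => w [vw nAw]; apply: nAw; apply: vA.
  by apply: agree_le vw; exact: leq_maxr.
exists u, l; split=> //; left; apply: meager_sub meager0 => w [uw Aw].
by apply: nv; exists w.
Qed.

Lemma baire_property_mod (N A B : set sample) :
  meager N -> (forall w, ~ N w -> (A w <-> B w)) -> baire_property A -> baire_property B.
Proof.
move=> mN AB bA u l; have [v [k [lk uv mA]]] := bA u l; exists v, k; split=> //.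
by case: mA => mA; [left|right]; apply: meager_sub (meagerU mN mA) => w [vw Bw];
  have [Nw|Nw] := pselect (N w); [left|right|left|right] => //; split=> //; apply/AB.
Qed.

Lemma nonmeager_localize A u l : baire_property A -> ~ meager (cyl u l `&` A) ->
  exists v k, [/\ (l <= k)%N, agree l u v & meager (cyl v k `\` A)].
Proof.
move=> bA; apply: contra_notP => nA; apply: locally_meager => v k lk uv.
have [w [k' [kk' vw [mA|mA]]]] := bA v k; first by exists w, k'.
case: nA; exists w, k'; split=> //; first exact: leq_trans kk'.
by apply: agree_trans uv _; exact: agree_le vw.
Qed.

(** Preserving [agree] at all large levels; together with being an involution this makes
    the map a homeomorphism, so that it preserves meagerness. *)
Definition eventually_isometric (h : sample -> sample) :=
  exists k, forall l u v, (k <= l)%N -> agree l u v -> agree l (h u) (h v).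

Lemma meager_preimage (h : sample -> sample) A :
  involutive h -> eventually_isometric h -> meager A -> meager (h @^-1` A).
Proof.
move=> hK [K hP] [N [ndN AN]]; exists (fun n => h @^-1` N n); split; last first.
  by move=> w /AN[n _ Nw]; exists n.
move=> n u l; have [v [k [lk uv vN]]] := ndN n (h u) (maxn l K).
have Kk : (K <= k)%N by apply: leq_trans lk; exact: leq_maxr.
exists (h v), k; split.
- by apply: leq_trans lk; exact: leq_maxl.
- apply: (@agree_le _ (maxn l K)); first exact: leq_maxl.
  by rewrite -(hK u); apply: hP => //; exact: leq_maxr.
- by move=> w vw; apply: vN; rewrite /cyl /= -(hK v); exact: hP.
Qed.

(** * Generic invariance under complementation *)

(** [base] and [relabel] only change the enumeration, so for good parameters they preserve
    the [E]-class of the resulting point. The classes given by [flip l w] for different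
    [l] are the same, but differ from the one given by [w]. *)
Definition flip (l : nat) (w : sample) :=
  Sample (bits w) (fun j => sel w j (+) (l <= j)%N) (idx w).

Definition base (w : sample) := Sample (bits w) (sel w) id.

Definition recolumn (t : nat -> nat) (w : sample) :=
  Sample (fun j => bits w (t j)) (fun j => sel w (t j)) (idx w).

Definition relabel (t : nat -> nat) (w : sample) :=
  Sample (bits w) (sel w) (fun m => t (idx w m)).

(** Exchanges [j] and [j + k] for [l <= j < k]. It fixes the columns below [l] and makes the
    columns of the block [[l, k)] independent of a condition on the columns below [k]. *)
Definition block_swap (l k j : nat) : nat :=
  if (l <= j < k)%N then (j + k)%N else if (k + l <= j < k + k)%N then (j - k)%N else j.

Lemma block_swapK l k : involutive (block_swap l k).
Proof. by move=> j; rewrite /block_swap; repeat case: ifPn; lia. Qed.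

Lemma block_swap_id l k j : (l <= k)%N -> (j < l)%N -> block_swap l k j = j.
Proof. by rewrite /block_swap => lk jl; repeat case: ifPn; lia. Qed.

Lemma block_swap_shift l k j : (l <= j < k)%N -> block_swap l k j = (j + k)%N.
Proof. by rewrite /block_swap => ->. Qed.

Lemma flipK l : involutive (flip l).
Proof.
by move=> [b s x]; rewrite /flip /=; congr Sample; apply/funext => j; rewrite addbK.
Qed.

Lemma flip_agree l k u v : agree k u v -> agree k (flip l u) (flip l v).
Proof. by move=> uv j jk; have [b s x] := uv j jk; split=> //=; rewrite s. Qed.

Lemma base_agree k u v : agree k u v -> agree k (base u) (base v).
Proof. by move=> uv j jk; have [b s x] := uv j jk. Qed.

Lemma flip_isometric l : eventually_isometric (flip l).
Proof. by exists 0%N => k u v _; exact: flip_agree. Qed.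

Lemma relabelK t : involutive t -> involutive (relabel t).
Proof.
by move=> tK [b s x]; rewrite /relabel /=; congr Sample; apply/funext => j; rewrite tK.
Qed.

Lemma relabel_isometric t : eventually_isometric (relabel t).
Proof.
exists 0%N => l u v _ uv j jl; have [b s x] := uv j jl; split=> //.
by rewrite /= x.
Qed.

Lemma recolumnK t : involutive t -> involutive (recolumn t).
Proof.
by move=> tK [b s x]; rewrite /recolumn /=; congr Sample; apply/funext => j; rewrite tK.
Qed.

Lemma recolumn_isometric l k : eventually_isometric (recolumn (block_swap l k)).
Proof.
exists (k + k)%N => m u v km uv j jm.
have sj : (block_swap l k j < m)%N by rewrite /block_swap; repeat case: ifPn; lia.
by have [b s _] := uv _ sj; have [_ _ x] := uv j jm.
Qed.

(** The last clause says that the set of indices changes its mind infinitely often. Unlike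
    being infinite, it is visibly stable under complementation beyond some index, and it
    makes all finite modifications of the set nonempty. *)
Definition good (w : sample) :=
  [/\ injective (bits w), forall v, exists m, idx w m = v &
      forall N, exists j, (N <= j)%N /\ sel w j <> sel w j.+1].

Lemma meager_bad : meager (~` good).
Proof.
pose B1 (p : nat * nat) : set sample := [set w | p.1 != p.2 /\ bits w p.1 = bits w p.2].
pose B2 (v : nat) : set sample := [set w | forall m, idx w m <> v].
pose B3 (N : nat) : set sample := [set w | forall j, (N <= j)%N -> sel w j = sel w j.+1].
apply: (@meager_sub _ (\bigcup_p B1 p `|` (\bigcup_v B2 v `|` \bigcup_N B3 N))).
  move=> w /= /not_and3P[/existsNP[j /existsNP[k]]|/existsNP[v nv]|/existsNP[N nN]].
  - by move=> /not_implyP[bjk /eqP jk]; left; exists (j, k).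
  - by right; left; exists v => // m mv; apply: nv; exists m.
  - right; right; exists N => // j Nj; apply: contrapT => sj; apply: nN.
    by exists j.
apply: meagerU; [|apply: meagerU]; apply: meager_bigcup.
- move=> [j k]; apply: nowhere_dense_meager => u l.
  have [->|jk] := eqVneq j k.
    by exists u, l; split=> // w _ [/=]; rewrite eqxx.
  pose c := (l + j + k)%N.
  exists (Sample (fun j' i => if i == c then j' == j else bits u j' i) (sel u) (idx u)), c.+1.
  split; [by rewrite /c; lia| |].
    by move=> j' j'l; split=> //= i il; case: eqP => // ic; rewrite /c in ic; lia.
  move=> w vw [_ /(congr1 (fun b => b c)) /=].
  have jc : (j < c.+1)%N by rewrite /c; lia.
  have kc : (k < c.+1)%N by rewrite /c; lia.
  have [/(_ c (ltnSn c)) <- _ _] := vw j jc.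
  have [/(_ c (ltnSn c)) <- _ _] := vw k kc.
  by rewrite /= !eqxx eq_sym (negbTE jk).
- move=> v; apply: nowhere_dense_meager => u l.
  exists (Sample (bits u) (sel u) (fun m => if m == l then v else idx u m)), l.+1.
  split; [by []|by move=> j jl; split=> //=; case: eqP => // ?; lia|].
  move=> w vw /(_ l); have [_ _ /=] := vw l (ltnSn l).
  by rewrite eqxx => ->.
- move=> N; apply: nowhere_dense_meager => u l.
  exists (Sample (bits u) (fun j => if (j < l)%N then sel u j else j == (N + l)%N) (idx u)),
    (N + l).+2.
  split; [by lia|by move=> j jl; split=> //=; rewrite jl|].
  move=> w vw /(_ (N + l)%N (leq_addr _ _)).
  have [_ <- _] := vw (N + l)%N (leqnSn _).
  have [_ <- _] := vw (N + l).+1 (ltnSn _).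
  by rewrite /= eqxx !ifF ?gtn_eqF //; lia.
Qed.

Lemma good_flip l w : good w -> good (flip l w).
Proof.
move=> [g1 g2 g3]; split=> // N; have [j [Nj sj]] := g3 (maxn N l).
exists j; split; first by apply: leq_trans Nj; exact: leq_maxl.
have lj : (l <= j)%N by apply: leq_trans Nj; exact: leq_maxr.
by rewrite /= lj (leq_trans lj (leqnSn j)) => /addIb.
Qed.

Lemma good_base w : good w -> good (base w).
Proof. by move=> [g1 g2 g3]; split=> // v; exists v. Qed.

(** The sequence [f] stands for the coordinates of the image of the parameter under a
    reduction. It is only used up to reordering, whence the existential quantifiers in
    [f_base] and [f_flip]. In contrast, [f_relabel] is an exact equality: permuting the
    columns and permuting the enumeration yield literally the same point of [P]. *)
Section GenericInvariants.
Variables (T : Type) (V : nat -> set T).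
Hypothesis V_sep : forall s t, (forall i, V i s <-> V i t) -> s = t.
Variable f : nat -> sample -> T.
Hypothesis f_baire : forall g : sample -> sample,
  (forall k u v, agree k u v -> agree k (g u) (g v)) ->
  (forall w, good w -> good (g w)) ->
  forall n i, baire_property [set w | V i (f n (g w))].
Hypothesis f_base : forall w n, good w -> exists m, f n w = f m (base w).
Hypothesis f_flip : forall w l n, good w -> exists m, f n (flip l w) = f m (flip 0 w).
Hypothesis f_relabel : forall t w n, involutive t ->
  f n (recolumn t w) = f n (relabel t w).

Let f_baire_eq (g h : sample -> sample) n m :
  (forall k u v, agree k u v -> agree k (g u) (g v)) ->
  (forall w, good w -> good (g w)) ->
  (forall k u v, agree k u v -> agree k (h u) (h v)) ->
  (forall w, good w -> good (h w)) ->
  baire_property [set w | f n (g w) = f m (h w)].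
Proof.
move=> gP gg hP hg.
have -> : [set w | f n (g w) = f m (h w)] = [set w | forall i,
    (V i (f n (g w)) -> V i (f m (h w))) /\ (V i (f m (h w)) -> V i (f n (g w)))].
  by apply/seteqP; split => w /= => [-> //|fw]; apply: V_sep => i; have [] := fw i.
have bg i := f_baire gP gg n i; have bh i := f_baire hP hg m i.
have S := baire_property_sigma.
by apply: (sigma_forall S) => i; apply: (sigma_and S); apply: (sigma_imp S);
  (exact: bg || exact: bh).
Qed.

(** The heart of the argument. Suppose that [S] separated [f n w] from [f n (flip L w)]
    generically on the cylinder of level [k] around [v]. The parameter [z] repeats in
    its columns [k, ..., 2k - 1] the columns [0, ..., k - 1] of [v] with the set of
    indices complemented. Near [z], swapping the block [[L, k)] with its copy turns [w]
    into a parameter lying, after [flip L], near [v] again. The swap can be moved to the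
    enumeration, on which [f n] does not depend near [u], so [f n] takes the same value
    on both sides of the separation. *)
Let separated_meager n m u l L (S : set T) :
  baire_property [set w | S (f n w) /\ ~ S (f n (flip L w))] ->
  meager (cyl u l `\` [set w | f n w = f m (base w)]) ->
  (l <= L)%N -> (forall i, (i < l)%N -> (idx u i < L)%N) ->
  meager (cyl u L `&` [set w | S (f n w) /\ ~ S (f n (flip L w))]).
Proof.
set A := [set w | S (f n w) /\ ~ S (f n (flip L w))].
move=> bA mB lL idxL; apply: contrapT => /(nonmeager_localize bA)[v [k [Lk uv mA]]].
pose z := Sample (fun j => bits v (if (j < k)%N then j else j - k)%N)
  (fun j => if (j < k)%N then sel v j else ~~ sel v (j - k)%N) (idx v).
pose t := block_swap L k.
have tK : involutive t := block_swapK L k.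
(* The four conditions place [w] in the generic part of the cylinder of [v] and of that of
   [u], and likewise for its images under the relabelling and the swap. *)
have [w zw] := baire z (k + k) (meagerU mA (meagerU mB (meagerU
  (meager_preimage (relabelK tK) (relabel_isometric t) mB)
  (meager_preimage (recolumnK tK) (recolumn_isometric L k)
    (meager_preimage (flipK L) (flip_isometric L) mA))))).
move=> /not_orP[nA1 /not_orP[nB1 /not_orP[nB2 nA2]]].
have vz : agree k v z by move=> j jk; split=> [i ik| |] /=; rewrite ?jk.
have vw : agree k v w by apply: agree_trans vz _; apply: agree_le zw; exact: leq_addr.
have uw : agree L u w by apply: agree_trans uv _; exact: agree_le vw.
have [Sw _] : A w by apply: contrapT => ?; apply: nA1.
have fw : f n w = f m (base w).
  by apply: contrapT => ?; apply: nB1; split=> //; exact: agree_le uw.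
have frw : f n (relabel t w) = f m (base w).
  apply: contrapT => ?; apply: nB2; split=> // j jl.
  have [b s x] := agree_le lL uw jl; split=> //.
  by rewrite /= -x /t block_swap_id // idxL.
have [_] : A (flip L (recolumn t w)).
  apply: contrapT => ?; apply: nA2; split=> // j jk.
  have [bj sj xj] := vw j jk; split=> [i ik||//] /=; have [jL|Lj] := ltnP j L.
  - by rewrite /t block_swap_id // bj.
  - have jkk : (j + k < k + k)%N by rewrite ltn_add2r.
    rewrite /t block_swap_shift ?Lj //; have [bz _ _] := zw _ jkk.
    by rewrite -bz ?ltn_addr //= ltnNge leq_addl /= addnK.
  - by rewrite addbF /t block_swap_id.
  - have jkk : (j + k < k + k)%N by rewrite ltn_add2r.
    rewrite /t block_swap_shift ?Lj //; have [_ <- _] := zw _ jkk.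
    by rewrite /= ltnNge leq_addl /= addnK addbT negbK.
by rewrite flipK f_relabel // frw -fw.
Qed.

(** Two distinct points of [T] are separated by some [V i] or by its complement, and there
    are countably many of those. *)
Let local_invariance n m u l L :
  meager (cyl u l `\` [set w | f n w = f m (base w)]) ->
  (l <= L)%N -> (forall i, (i < l)%N -> (idx u i < L)%N) ->
  meager (cyl u L `\` [set w | f n w = f n (flip L w)]).
Proof.
move=> mB lL idxL.
pose A (p : nat * bool) : set T := if p.2 then V p.1 else ~` V p.1.
apply: (@meager_sub _ (\bigcup_p (cyl u L `&`
    [set w | A p (f n w) /\ ~ A p (f n (flip L w))]))).
  move=> w [uw fw]; apply: contrapT => nA; apply: fw; apply: V_sep => i; split=> Vi.
    by apply: contrapT => nVi; apply: nA; exists (i, true).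
  apply: contrapT => nVi; apply: nA; exists (i, false) => //.
  by split=> //; split=> // /(_ Vi).
have S := baire_property_sigma.
apply: meager_bigcup => -[i b]; apply: separated_meager mB lL idxL.
have b1 : baire_property [set w | V i (f n w)].
  exact: (f_baire (g := id) (fun _ _ _ => id) (fun _ => id)).
have b2 : baire_property [set w | V i (f n (flip L w))].
  exact: (f_baire (@flip_agree L) (@good_flip L)).
case: b; rewrite /A /=; apply: (sigma_and S).
- exact: b1.
- exact: (sigmaC S b2).
- exact: (sigmaC S b1).
- exact: (sigmaC S (sigmaC S b2)).
Qed.

Lemma generic_flip : meager [set w | exists n, forall m, f n w <> f m (flip 0 w)].
Proof.
pose bad n : set sample := [set w | forall m, f n w <> f m (flip 0 w)].
apply: (@meager_sub _ (\bigcup_n bad n)); first by move=> w [n ?]; exists n.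
apply: meager_bigcup => n; apply: contrapT => nm.
have idP (k : nat) (u v : sample) : agree k u v -> agree k (id u) (id v) by [].
have idg (w : sample) : good w -> good (id w) by [].
have S := baire_property_sigma.
have b_bad : baire_property (bad n).
  apply: (sigma_forall S) => m; apply: (sigmaC S).
  exact: f_baire_eq idP idg (@flip_agree 0) (@good_flip 0).
pose u0 := Sample (fun _ _ => false) (fun=> false) id.
have [|v [k [_ _ mv]]] := @nonmeager_localize _ u0 0 b_bad.
  by apply: contra_not nm; apply: meager_sub => w bw; split.
pose M m : set sample := [set w | f n w = f m (base w)].
(* The values of [f n] lie in the countable set of values at [base w], so one of the sets
   [M m] is not meager. *)
have [m nmM] : exists m, ~ meager (cyl v k `&` M m).
  apply: contrapT => /forallNP mM.
  have [|w vw] := @baire (~` good `|` \bigcup_m (cyl v k `&` M m)) v k.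
    apply: meagerU meager_bad _; apply: meager_bigcup => m; exact: contrapT (mM m).
  move=> /not_orP[/contrapT gw]; apply; have [m fm] := f_base n gw.
  by exists m.
have bM : baire_property (M m).
  exact: f_baire_eq idP idg base_agree good_base.
have [u [l [kl vu mM]]] := nonmeager_localize bM nmM.
(* Beyond [l] and beyond all the values of the enumeration fixed by the cylinder, columns
   may be permuted without leaving it. *)
pose L := maxn l (\max_(i < l) (idx u i).+1).
have lL : (l <= L)%N by exact: leq_maxl.
have idxL i : (i < l)%N -> (idx u i < L)%N.
  move=> il; apply: leq_trans (leq_maxr _ _).
  exact: (leq_bigmax (F := fun i : 'I_l => (idx u i).+1) (Ordinal il)).
have [w uw] := baire u L (meagerU meager_bad (meagerU mv (local_invariance mM lL idxL))).
move=> /not_orP[/contrapT gw /not_orP[nb ninv]].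
have bw : bad n w.
  apply: contrapT => nbw; apply: nb; split=> //.
  by apply: agree_trans vu _; apply: agree_le uw; exact: leq_trans lL.
have fw : f n w = f n (flip L w) by apply: contrapT => ?; apply: ninv.
by have [m' fm'] := f_flip L n gw; apply: (bw m'); rewrite fw.
Qed.

End GenericInvariants.

(** * An injective continuous map from binary sequences to the reals *)

Section TernaryEmbedding.
Variable R : realType.
Implicit Types a b : nat -> bool.

Definition ternary_sum a n : R := \sum_(i < n) (a i)%:R * 3^-1 ^+ i.

(** Bounds the sum of the digits from place [n] on. It is half as large as the place value
    of digit [n - 1]; this gap makes the map injective. *)
Definition ternary_tail n : R := 3 / 2 * 3^-1 ^+ n.

Definition ternary a : R := sup (range (ternary_sum a)).

Lemma ternary_sumS a n :
  ternary_sum a n.+1 = ternary_sum a n + (a n)%:R * (2 * ternary_tail n.+1).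
Proof.
rewrite /ternary_sum big_ord_recr /=; congr (_ + _ * _).
by rewrite /ternary_tail exprS; lra.
Qed.

Lemma ternary_tailS n : ternary_tail n = 3 * ternary_tail n.+1.
Proof. by rewrite /ternary_tail exprS; lra. Qed.

Lemma ternary_tail_gt0 n : 0 < ternary_tail n.
Proof. by rewrite /ternary_tail mulr_gt0 ?exprn_gt0 ?divr_gt0 ?invr_gt0. Qed.

Lemma ternary_sum_le a n m : (n <= m)%N ->
  ternary_sum a n <= ternary_sum a m /\
  ternary_sum a m + ternary_tail m <= ternary_sum a n + ternary_tail n.
Proof.
elim: m => [|m IH]; first by rewrite leqn0 => /eqP ->.
rewrite leq_eqVlt => /orP[/eqP -> //|/IH].
rewrite ternary_sumS (ternary_tailS m); have := ternary_tail_gt0 m.+1.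
by case: (a m) => /=; lra.
Qed.

Lemma ternary_bounds a n :
  ternary_sum a n <= ternary a <= ternary_sum a n + ternary_tail n.
Proof.
have ub m : ternary_sum a m <= ternary_sum a n + ternary_tail n.
  have [/(ternary_sum_le a)[_]|/ltnW/(ternary_sum_le a)[]] := leqP n m.
    by have := ternary_tail_gt0 m; lra.
  by have := ternary_tail_gt0 n; lra.
apply/andP; split.
  by apply: sup_ubound; [exists (ternary_sum a n + ternary_tail n) => _ [m _ <-]|exists n].
by apply: ge_sup; [exists (ternary_sum a n); exists n|move=> _ [m _ <-]].
Qed.

Lemma ternary_inj : injective ternary.
Proof.
have lt_first a b n : (forall i, (i < n)%N -> a i = b i) -> a n -> ~~ b n ->
    ternary b < ternary a.
  move=> ab an bn; have /andP[la _] := ternary_bounds a n.+1.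
  have /andP[_ ub] := ternary_bounds b n.+1.
  have eab : ternary_sum a n = ternary_sum b n.
    by apply: eq_bigr => i _; rewrite ab.
  move: la ub; rewrite !ternary_sumS an (negbTE bn) eab /=.
  by have := ternary_tail_gt0 n.+1; lra.
move=> a b tab; apply/funext => n0; apply: contrapT => abn0.
have ex_diff : exists n, a n != b n by exists n0; apply/eqP.
have [n abn n_min] := ex_minnP ex_diff.
have ab i : (i < n)%N -> a i = b i.
  by move=> ilt; apply/eqP; apply: contraLR ilt => /n_min; rewrite -leqNgt.
have := lt_first a b n ab; have := lt_first b a n (fun i il => esym (ab i il)).
rewrite tab ltxx; move: abn.
by case: (a n); case: (b n) => // _ ba ab'; [have := ab' isT isT|have := ba isT isT].
Qed.

Lemma ternary_close a b n : (forall i, (i < n)%N -> a i = b i) ->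
  `|ternary a - ternary b| <= ternary_tail n.
Proof.
move=> ab; have := ternary_bounds a n; have := ternary_bounds b n.
have -> : ternary_sum a n = ternary_sum b n by apply: eq_bigr => i _; rewrite ab.
by rewrite ler_norml => /andP[? ?] /andP[? ?]; apply/andP; split; lra.
Qed.

Lemma ternary_tail_small e : 0 < e -> exists n, ternary_tail n < e.
Proof.
move=> e0; pose N := Num.bound (2 / e); exists N.
have N3 : (N < 3 ^ N)%N by exact: ltn_expl.
have eN : 2 / e < N%:R by apply: archi_boundP; rewrite divr_ge0 // ltW.
have N0 : 0 < N%:R :> R by apply: lt_trans eN; rewrite divr_gt0.
have : 3^-1 ^+ N < N%:R^-1 :> R.
  by rewrite exprVn ltf_pV2 ?posrE ?exprn_gt0 // -natrX ltr_nat.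
have : N%:R^-1 < e / 2 :> R.
  by rewrite -[ltRHS]invrK ltf_pV2 ?posrE ?invr_gt0 ?divr_gt0 // invf_div.
by rewrite /ternary_tail; lra.
Qed.

End TernaryEmbedding.

(** * The point of P given by a parameter *)

Section Instance.
Variable R : realType.

Definition decode (t : nat) : seq nat := odflt [::] (unpickle t).

(** The reals are listed along [idx w]. The rows are indexed by finite sequences [t]; row [t]
    modifies the set [sel w] at the indices that the enumeration takes on [t]. Going
    through the enumeration, rather than modifying at the members of [t] itself, makes the
    code a function of the composites of the columns with [idx w]: permuting the
    columns then has exactly the effect of permuting the enumeration. *)
Definition code (w : sample) : X_space R * Y_space :=
  ((fun m => ternary R (bits w (idx w m))) : X_space R,
   (fun t m => sel w (idx w m) (+) (idx w m \in map (idx w) (decode t))) : Y_space).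

Lemma leq_mem_sumn (s : seq nat) n : n \in s -> (n <= sumn s)%N.
Proof.
elim: s => //= k s IH; rewrite in_cons => /orP[/eqP ->|/IH ns]; first exact: leq_addr.
exact: leq_trans (leq_addl _ _).
Qed.

Lemma code_continuous (O : set (X_space R * Y_space)) w : open O -> O (code w) ->
  exists l, cyl w l `<=` code @^-1` O.
Proof.
move=> oO Ow; pose F := filter_from [set: nat] (cyl w).
have FF : Filter F.
  apply: filter_from_filter; first by exists 0%N.
  move=> i j _ _; exists (maxn i j) => // v wv; split.
    by apply: agree_le wv; exact: leq_maxl.
  by apply: agree_le wv; exact: leq_maxr.
suff : code @ F --> code w.
  by move=> /(_ O (open_nbhs_nbhs (conj oO Ow)))[l _ lO]; exists l.
have code1 : (fun v => (code v).1) @ F --> (code w).1.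
  apply: (@ptws_cvg R) => n; apply/cvgrPdist_lt => e e0; have [l le] := ternary_tail_small e0.
  exists (l + n + (idx w n)).+1 => // v wv /=.
  have [|_ _ <-] := wv n; first by lia.
  apply: le_lt_trans le; apply: ternary_close => i il.
  by have [|b _ _] := wv (idx w n); [lia|apply: b; lia].
have code2 : (fun v => (code v).2) @ F --> (code w).2.
  apply: (@ptws_cvg cantor_space) => n; apply: (@ptws_cvg bool) => m.
  apply: cvg_near_cst.
  exists (m + idx w m + sumn (decode n)).+1 => // v wv /=.
  have [|_ _ <-] := wv m; first by lia.
  have [|_ <- _] := wv (idx w m); first by lia.
  congr (_ (+) (_ \in _)); apply/esym/eq_in_map => k /leq_mem_sumn kn.
  by have [|_ _ <-] := wv k; first by lia.
exact: cvg_pair code1 code2.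
Qed.

(** The finite modifications of the set of reals selected by [w], indexed by the places of
    the modification. They are the sets [A_n] of the code, and do not involve the
    enumeration. *)
Definition trace (w : sample) (s : seq nat) : set R :=
  [set ternary R (bits w j) | j in [set j | sel w j (+) (j \in s)]].

Lemma range_A_code w : good w -> range (A_set (code w)) = range (trace w).
Proof.
move=> [_ idx_surj _]; have [g gP] := choice idx_surj.
have AE t : A_set (code w) t = trace w (map (idx w) (decode t)).
  apply/seteqP; split => _ [m /= mt <-]; first by exists (idx w m).
  by exists (g m); rewrite /= gP.
apply/seteqP; split=> _ [t _ <-]; first by rewrite AE; eexists.
exists (pickle (map g t)) => //; rewrite AE /decode pickleK /= -map_comp.
by congr (trace w _); rewrite -[RHS]map_id; apply: eq_map => j /=; rewrite gP.
Qed.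

Lemma code_P w : good w -> P_set (code w).
Proof.
move=> [bits_inj idx_surj sel_alt]; split=> /=.
- move=> m; case sm: (sel w (idx w m)).
    by exists (pickle ([::] : seq nat)); rewrite /decode pickleK.
  by exists (pickle [:: m]); rewrite /decode pickleK /= inE eqxx.
- move=> t; pose s := map (idx w) (decode t).
  have [j [sj wj]] := sel_alt (sumn s).+1.
  have out i : (j <= i)%N -> (i \in s) = false.
    by move=> ji; apply: contraTF isT => /leq_mem_sumn; lia.
  have [i [ji wi]] : exists i, (j <= i)%N /\ sel w i = true.
    case wj0: (sel w j); first by exists j.
    by exists j.+1; split=> //; move: wj; rewrite wj0; case: (sel w j.+1).
  by have [m mi] := idx_surj i; exists m; rewrite mi wi out.
- by move=> t l1 l2 /ternary_inj/bits_inj ->.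
Qed.

(** The two complementations differ only at the indices below [l], which a finite
    modification can absorb. *)
Lemma trace_flip l w : range (trace (flip l w)) = range (trace (flip 0 w)).
Proof.
pose sym (s : seq nat) := [seq j <- iota 0 l ++ s | (j < l)%N (+) (j \in s)].
have symE s j : (j \in sym s) = (j < l)%N (+) (j \in s).
  by rewrite mem_filter mem_cat mem_iota /= add0n; case: (_ < _)%N; case: (_ \in _).
have eq_trace u v s s' : bits u = bits v ->
    (forall j, sel u j (+) (j \in s) = sel v j (+) (j \in s')) -> trace u s = trace v s'.
  move=> uv e; rewrite /trace uv; congr image.
  by apply/seteqP; split=> j; rewrite /= e.
apply/seteqP; split=> _ [s _ <-]; exists (sym s) => //; apply: eq_trace => //= j.
  by rewrite symE leq0n (leqNgt l); case: (sel w j); case: (_ < _)%N; case: (_ \in _).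
by rewrite symE leq0n (leqNgt l); case: (sel w j); case: (_ < _)%N; case: (_ \in _).
Qed.

(** A set of indices and a finite modification of its complement disagree at every index
    outside of the modification. *)
Lemma trace_flip0_neq w : good w -> range (trace w) <> range (trace (flip 0 w)).
Proof.
move=> [bits_inj _ _] e.
have [s _ es] : range (trace (flip 0 w)) (trace w [::]) by rewrite -e; exists [::].
pose j := (sumn s).+1.
have js : (j \in s) = false by apply: contraTF isT => /leq_mem_sumn; rewrite ltnn.
have traceP u s' : injective (bits u) ->
    trace u s' (ternary R (bits u j)) <-> sel u j (+) (j \in s').
  by move=> u_inj; split=> [[i /= si /ternary_inj/u_inj <-]|sj] //; exists j.
have := traceP w [::] bits_inj; rewrite -es.
by rewrite (traceP (flip 0 w) s bits_inj) /= js in_nil !addbF addbT; case: (sel w j) => -[]; intuition.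
Qed.

Lemma P_default : P_set ((fun=> 0) : X_space R, (fun _ _ => true) : Y_space).
Proof. by split=> //= [m|k]; exists 0%N. Qed.

(** The points outside of [P] are sent to an arbitrary point of [P]; generic parameters have
    their code in [P], so the choice is immaterial. *)
Definition to_P (p : X_space R * Y_space) : set_type (@P_set R) :=
  if pselect (P_set p) is left h then SigSub (mem_set h)
  else SigSub (mem_set P_default).

Lemma to_PK p : P_set p -> set_val (to_P p) = p.
Proof. by rewrite /to_P; case: pselect. Qed.

Definition point (w : sample) := to_P (code w).

Lemma point_E v w : good v -> good w ->
  E_rel (point v) (point w) <-> range (trace v) = range (trace w).
Proof.
by move=> gv gw; rewrite /E_rel /point !to_PK ?range_A_code //; exact: code_P.
Qed.

(** On good parameters [point] is the continuous map [code], and the others form a meager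
    set. *)
Lemma point_baire (g : sample -> sample) (B : set (set_type (@P_set R))) :
  (forall k u v, agree k u v -> agree k (g u) (g v)) ->
  (forall w, good w -> good (g w)) ->
  borel B -> baire_property [set w | B (point (g w))].
Proof.
move=> g_agree g_good; have S := baire_property_sigma.
apply: (borel_ind (Q := fun B => baire_property [set w | B (point (g w))])).
- move=> _ [U oU <-]; apply: (baire_property_mod meager_bad (A := [set w | U (code (g w))])).
    by move=> w /contrapT gw; rewrite /= /point to_PK //; exact/code_P/g_good.
  apply: baire_property_open => u Ou; have [l lU] := code_continuous oU Ou.
  by exists l => w uw; apply: lU; exact: g_agree.
- by move=> A bA; exact: (sigmaC S).
- move=> A bA; suff : baire_property [set w | exists n, A n (point (g w))].
    congr baire_property; apply/seteqP; split=> w /= [n]; first by exists n.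
    by move=> _; exists n.
  exact: (sigma_exists S).
Qed.

End Instance.

Arguments trace R w s : clear implicits.

(** * Non-reducibility *)

Definition rational_halfline (R : realType) (i : nat) : set R :=
  if unpickle i is Some q then [set x | ratr q < x] else set0.

Lemma rational_halflines_separate (R : realType) (s t : R) :
  (forall i, rational_halfline i s <-> rational_halfline i t) -> s = t.
Proof.
have sep (x y : R) : (forall i, rational_halfline i x -> rational_halfline i y) -> x <= y.
  move=> xy; rewrite leNgt; apply/negP => /rat_in_itvoo[q].
  rewrite in_itv /= => /andP[yq qx]; have := xy (pickle q).
  by rewrite /rational_halfline pickleK /= => /(_ qx) /(lt_trans yq); rewrite ltxx.
by move=> st; apply/eqP; rewrite eq_le !sep // => i /st.
Qed.

Lemma borel_rational_halfline (R : realType) i : borel (@rational_halfline R i).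
Proof.
rewrite /rational_halfline; case: unpickle => [q|]; apply: borel_open.
  exact: open_gt.
exact: open0.
Qed.

Lemma E_not_reducible (R : realType) :
  ~ borel_reducible (@E_rel R) (prod_rel (@F_rel R) G_rel).
Proof.
move=> [f [bf fE]].
pose fX n (w : sample) : R := (f (point R w)).1 n.
pose fY n (w : sample) : cantor_space := (f (point R w)).2 n.
have f_inv v w : good v -> good w -> range (trace R v) = range (trace R w) ->
    (forall n, exists m, fX n v = fX m w) /\ (forall n, exists m, fY n v = fY m w).
  by move=> gv gw /(point_E R gv gw)/fE[[? _] [? _]].
have inv_base w : good w ->
    (forall n, exists m, fX n w = fX m (base w)) /\ (forall n, exists m, fY n w = fY m (base w)).
  by move=> gw; apply: f_inv => //; exact: good_base.
have inv_flip w l : good w ->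
    (forall n, exists m, fX n (flip l w) = fX m (flip 0 w)) /\
    (forall n, exists m, fY n (flip l w) = fY m (flip 0 w)).
  by move=> gw; apply: f_inv; [exact: good_flip|exact: good_flip|exact: trace_flip].
have point_relabel t w : involutive t -> point R (recolumn t w) = point R (relabel t w).
  move=> tK; rewrite /point; congr (to_P (_, _)).
  apply/funext => k; apply/funext => m; congr (_ (+) _).
  by rewrite /= (map_comp t) (mem_map (inv_inj tK)).
have mX : meager [set w | exists n, forall m, fX n w <> fX m (flip 0 w)].
  apply: (generic_flip (@rational_halflines_separate R)).
  - move=> g g_agree g_good n i.
    apply: (point_baire (B := f @^-1` [set p | rational_halfline i (p.1 n)])) => //.
    apply: bf; have c : continuous (fun p : X_space R * Y_space => p.1 n).
      by apply: X_coord_continuous => p; exact: cvg_fst.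
    have := continuous_borel_fun c (B := rational_halfline i); apply.
    exact: borel_rational_halfline.
  - by move=> w n gw; exact: (inv_base w gw).1.
  - by move=> w l n gw; exact: (inv_flip w l gw).1.
  - by move=> t w n tK; rewrite /fX point_relabel.
have mY : meager [set w | exists n, forall m, fY n w <> fY m (flip 0 w)].
  apply: (generic_flip (V := fun i => [set a : cantor_space | a i = true])).
  - by move=> a b ab; apply/funext => i; apply/idP/idP => /ab.
  - move=> g g_agree g_good n i.
    apply: (point_baire (B := f @^-1` [set p | p.2 n i = true])) => //.
    apply: bf; apply: borel_true.
    by apply: Y_coord_continuous => p; exact: cvg_snd.
  - by move=> w n gw; exact: (inv_base w gw).2.
  - by move=> w l n gw; exact: (inv_flip w l gw).2.
  - by move=> t w n tK; rewrite /fY point_relabel.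
have mback A : meager A -> meager (flip 0 @^-1` A).
  exact: meager_preimage (flipK 0) (flip_isometric 0).
have [w _] := baire (Sample (fun _ _ => false) (fun=> false) id) 0
  (meagerU meager_bad (meagerU (meagerU mX mY) (meagerU (mback _ mX) (mback _ mY)))).
move=> /not_orP[/contrapT gw /not_orP[/not_orP[gX gY] /not_orP[gX' gY']]].
have ex (T : Type) (h : nat -> sample -> T) v v' :
    ~ (exists n, forall m, h n v <> h m v') -> forall n, exists m, h n v = h m v'.
  by move=> nh n; apply: contrapT => /forallNP nhn; apply: nh; exists n.
apply: (trace_flip0_neq (R := R) gw).
apply/(point_E R gw (good_flip 0 gw))/fE; split.
  by split; [exact: ex gX|apply: (ex _ fX); rewrite /= flipK in gX'].
by split; [exact: ex gY|apply: (ex _ fY); rewrite /= flipK in gY'].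
Qed.

(** * The theorem *)

Theorem theorem6 (R : realType) :
  (* (i) *)
  [/\ borel (@P_set R), borel_equivalence (@E_rel R),
      borel_equivalence (@F_rel R) & borel_equivalence G_rel] /\
  (* (ii) *)
  (forall p q : set_type (@P_set R),
     E_rel p q -> F_rel (set_val p).1 (set_val q).1) /\
  (* (iii) *)
  (forall x0 : X_space R,
     borel_reducible
       (restrict_rel (@E_rel R) (Q := over_class (P := @P_set R) (@F_rel R) x0))
       G_rel) /\
  (* (iv) *)
  ~ borel_reducible (@E_rel R) (prod_rel (@F_rel R) G_rel) /\
  (* consequence *)
  ~ (forall (X Y : topologicalType), polish R X -> polish R Y ->
     forall P : set (X * Y), borel P ->
     forall F : X -> X -> Prop, borel_equivalence F ->
     forall E : set_type P -> set_type P -> Prop, borel_equivalence E ->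
     (forall p q : set_type P, E p q -> F (set_val p).1 (set_val q).1) ->
     forall Z : topologicalType, polish R Z ->
     forall G : Z -> Z -> Prop, borel_equivalence G ->
     (forall x0 : X,
        borel_reducible (restrict_rel E (Q := over_class (P := P) F x0)) G) ->
     borel_reducible E (prod_rel F G)).
Proof.
have i : [/\ borel (@P_set R), borel_equivalence (@E_rel R),
    borel_equivalence (@F_rel R) & borel_equivalence G_rel].
  split; [exact: borel_P_set|exact: borel_equivalence_E|
          exact: borel_equivalence_F|exact: borel_equivalence_G].
split=> //; split; first exact: E_rel_F_rel.
split; first exact: restricted_E_reducible.
split; first exact: E_not_reducible.
move: i => [bP bE bF bG] all_reducible; apply: (@E_not_reducible R).
apply: (all_reducible _ _ (polish_X R) (polish_Y R) _ bP _ bF _ bE (@E_rel_F_rel R)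
  _ (polish_Y R) _ bG).
exact: restricted_E_reducible.
Qed.
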